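(* Let $p$ be a prime, let $G$ be an abelian group which is a direct sum of cyclic $p$-groups (with an arbitrary, possibly infinite, index set), and let $U\subseteq G$ be a subgroup such that $p(G/U)=0$. Then the pair $(G,U)$ is isomorphic to a direct sum of pickets each of which is of type $P^n_n=(\mathbb Z/(p^n),\mathbb Z/(p^n))$ or $P^n_{n-1}=(\mathbb Z/(p^n),p\mathbb Z/(p^n))$ for some $n\ge 1$. Moreover, this direct sum decomposition is unique up to reordering and isomorphism of the summands.
   Context: A pair $(G,U)$ consists of an abelian group $G$ and a subgroup $U\subseteq G$. A morphism of pairs $(G,U)\to(G',U')$ is a group homomorphism $f:G\to G'$ with $f(U)\subseteq U'$; isomorphisms of pairs are the invertible such morphisms. The direct sum of pairs $(G_i,U_i)_{i\in I}$ is $(\bigoplus_i G_i,\bigoplus_i U_i)$. A picket is a pair $(G,U)$ in which $G$ is a cyclic $p$-group. Note that $P^1_0=(\mathbb Z/(p),0)$. *)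

(* Defs.v *)
From mathcomp Require Import all_boot all_algebra.
From Stdlib Require Import List.
Set Implicit Arguments. Unset Strict Implicit. Unset Printing Implicit Defensive.
Import GRing.Theory.
Local Open Scope ring_scope.

Definition is_subgroup (G : zmodType) (U : G -> Prop) : Prop :=
  U 0 /\ (forall x y, U x -> U y -> U (x - y)).

(* External direct sum  (+)_{i in I} Z/(p^(n i)):  elements are functions
   f : I -> nat with f i < p^(n i) (canonical residues) and finite support;
   addition is componentwise modulo p^(n i). *)
Definition dsum_elem (I : Type) (p : nat) (n : I -> nat) (f : I -> nat) : Prop :=
  (forall i, (f i < p ^ n i)%N) /\
  exists s : list I, forall i, ~ List.In i s -> f i = 0%N.

Definition dsum_add (I : Type) (p : nat) (n : I -> nat) (f g : I -> nat) : I -> nat :=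
  fun i => ((f i + g i) %% p ^ n i)%N.

Definition dsum_iso (G : zmodType) (I : Type) (p : nat) (n : I -> nat)
    (phi : G -> I -> nat) : Prop :=
  [/\ forall x, dsum_elem p n (phi x),
      forall x y, phi (x + y) = dsum_add p n (phi x) (phi y),
      injective phi &
      forall f, dsum_elem p n f -> exists x, phi x = f].

Definition direct_sum_cyclic_pgroups (G : zmodType) (p : nat) : Prop :=
  exists (I : Type) (n : I -> nat) (phi : G -> I -> nat), dsum_iso p n phi.

(* Second component of the picket of type (n, t) inside Z/(p^n):
   t = true  : P^n_n     = (Z/(p^n), Z/(p^n))
   t = false : P^n_{n-1} = (Z/(p^n), pZ/(p^n)) (residues divisible by p). *)
Definition picket_sub (p : nat) (t : bool) (k : nat) : Prop :=
  if t then True else (p %| k)%N.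

Definition picket_decomp (G : zmodType) (U : G -> Prop) (p : nat)
    (J : Type) (m : J -> nat) (t : J -> bool) : Prop :=
  (forall j, (0 < m j)%N) /\
  exists phi : G -> J -> nat,
    dsum_iso p m phi /\
    (forall x, U x <-> forall j, picket_sub p (t j) (phi x j)).

(* Main.v *)
(* Existence: let (e_i) be the given basis of G and well-order the index set
   compatibly with the orders p^(n i). Put x_i = an element of U of the form
   e_i + (combination of smaller basis elements) when there is one, and x_i = e_i
   otherwise. Every smaller basis element is killed by p^(n i), so e_i |-> x_i
   extends to an endomorphism of G; it preserves leading terms, hence is bijective.
   A combination of the x_i lies in U iff its coefficients at the indices of the
   second kind are divisible by p: a leading coefficient prime to p could be
   normalised to 1, which makes the index one of the first kind.

   Uniqueness: the pickets of each type give a basis of a quotient of successive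
   terms of a filtration of G by subgroups containing pG and defined from (G,U)
   alone. Gaussian elimination along well-orderings injects each such basis into
   any other, and Cantor-Bernstein concludes. *)

Require Import Defs.
From mathcomp Require Import all_boot all_algebra.
From mathcomp Require Import boolp wochoice zify.
From Stdlib Require List.
Set Implicit Arguments. Unset Strict Implicit. Unset Printing Implicit Defensive.
Import GRing.Theory.

(** * Well-orderings and leading indices *)

Definition least (I : Type) (le : I -> I -> Prop) (P : I -> Prop) (i : I) : Prop :=
  P i /\ forall j, P j -> le i j.

Definition greatest (I : Type) (le : I -> I -> Prop) (P : I -> Prop) (i : I) : Prop :=
  P i /\ forall j, P j -> le j i.

(** Least elements of sets of one, two and three points give reflexivity, totality and transitivity,
    so only antisymmetry is added. *)
Definition woset (I : Type) (le : I -> I -> Prop) : Prop :=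
  (forall i j, le i j -> le j i -> i = j) /\
  (forall P : I -> Prop, (exists i, P i) -> exists i, least le P i).

Lemma wo_total I (le : I -> I -> Prop) : woset le -> forall i j, le i j \/ le j i.
Proof.
move=> [_ wo] i j; have [|k [[->|->] kle]] := wo (fun k => k = i \/ k = j).
- by exists i; left.
- by left; apply: kle; right.
- by right; apply: kle; left.
Qed.

Lemma wo_refl I (le : I -> I -> Prop) : woset le -> forall i, le i i.
Proof. by move=> /wo_total tot i; case: (tot i i). Qed.

Lemma wo_trans I (le : I -> I -> Prop) : woset le ->
  forall j i k, le i j -> le j k -> le i k.
Proof.
move=> [anti wo] j i k ij jk.
have [|l [Pl lle]] := wo (fun l => [\/ l = i, l = j | l = k]).
  by exists i; constructor.
have [li lj lk] : [/\ le l i, le l j & le l k].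
  by split; apply: lle; [constructor 1|constructor 2|constructor 3].
by case: Pl => El; subst l => //; [rewrite (anti i j)|rewrite -(anti j k) // ?(anti j k)].
Qed.

Lemma wo_ind I (le : I -> I -> Prop) (P : I -> Prop) : woset le ->
  (forall i, (forall j, le j i -> j <> i -> P j) -> P i) -> forall i, P i.
Proof.
move=> [anti wo] IH i; apply: contrapT => nPi.
have [|k [nPk kmin]] := wo (fun k => ~ P k); first by exists i.
apply: nPk; apply: IH => j jk nejk; apply: contrapT => nPj.
by apply: nejk; apply: anti => //; apply: kmin.
Qed.

(** This supplies leading indices: a nonzero element has finite nonempty support, confined to a
    list. *)
Lemma wo_greatest I (le : I -> I -> Prop) (P : I -> Prop) (s : list I) :
  woset le -> (forall i, P i -> List.In i s) -> (exists i, P i) ->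
  exists i, greatest le P i.
Proof.
move=> wo; elim: s P => [|a s IH] P Ps [i Pi]; first by case: (Ps i Pi).
have [nP|] := pselect (forall j, P j -> j = a).
  have Ea := nP i Pi; subst i; exists a; split=> // j /nP ->; exact: wo_refl.
move=> /existsNP[j /not_implyP[Pj ja]].
have [||k [[Pk ka] kmax]] := IH (fun k => P k /\ k <> a).
- by move=> k [/Ps[->|] //].
- by exists j.
have [Pa|nPa] := pselect (P a); last first.
  by exists k; split=> // l Pl; apply: kmax; split=> // la; apply: nPa; rewrite -la.
have [ak|ka'] := wo_total wo a k.
  exists k; split=> // l Pl; have [->//|la] := pselect (l = a).
  exact: kmax.
exists a; split=> // l Pl; have [->|la] := pselect (l = a); first exact: wo_refl.
by apply: (wo_trans wo) ka'; apply: kmax.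
Qed.

(** Lexicographic order: compare [n] first, then break ties by an arbitrary well-ordering of [I]. *)
Lemma wo_graded (I : Type) (n : I -> nat) :
  exists le : I -> I -> Prop, woset le /\ forall i j, le i j -> (n i <= n j)%N.
Proof.
have [R woR] := well_ordering_principle {classic I}.
have Rmin (P : I -> Prop) : (exists i, P i) -> exists i, P i /\ forall j, P j -> R i j.
  case=> i Pi; have [|k [[Pk kmin] _]] := woR (fun i => `[< P i >]).
    by exists i; apply/asboolP.
  exists k; split; first exact/asboolP.
  by move=> j Pj; apply: kmin; apply/asboolP.
have Ranti (i j : I) : R i j -> R j i -> i = j.
  (* Both [i] and [j] are least in the set of the two, so uniqueness of the minimum identifies
     them. *)
  move=> ij ji; pose A : pred {classic I} := fun k => `[< k = i \/ k = j >].
  have Rii k : R k k.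
    by have [|l [-> /(_ k erefl)]] := Rmin (fun l => l = k); [exists k|].
  have [|k [_ uniqk]] := woR A; first by exists i; apply/asboolP; left.
  have Ei : k = i.
    apply: uniqk; split; first by apply/asboolP; left.
    by move=> l /asboolP[->|->].
  have Ej : k = j.
    apply: uniqk; split; first by apply/asboolP; right.
    by move=> l /asboolP[->|->].
  by rewrite -Ei -Ej.
exists (fun i j => (n i < n j)%N \/ n i = n j /\ R i j); split; last first.
  by move=> i j [/ltnW|[->]].
split=> [i j [ij|[Eij Rij]] [ji|[Eji Rji]]|P [i Pi]]; try lia.
  exact: Ranti.
pose Q k := `[< exists i, P i /\ n i = k >].
have exQ : exists k, Q k by exists (n i); apply/asboolP; exists i.
case: (ex_minnP exQ) => k /asboolP[i1 [Pi1 <-]] kmin.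
have [|j [[Pj Ej] jmin]] := Rmin (fun j => P j /\ n j = n i1); first by exists i1.
exists j; split=> // l Pl.
have /kmin nl : Q (n l) by apply/asboolP; exists l.
have [lt|eq] : (n i1 < n l)%N \/ n l = n i1 by lia.
  by left; rewrite Ej.
by right; rewrite Ej eq; split=> //; apply: jmin.
Qed.

(** * Cantor-Bernstein for labelled sets *)

Lemma graded_Cantor_Bernstein (I J K : Type) (c : I -> K) (d : J -> K)
    (f : I -> J) (g : J -> I) :
  injective f -> injective g ->
  (forall i, d (f i) = c i) -> (forall j, c (g j) = d j) ->
  exists h : I -> J, bijective h /\ forall i, d (h i) = c i.
Proof.
move=> fI gI fc gd.
(* The least set containing the complement of the image of g and closed under g \o f. *)
pose C i := forall S : I -> Prop, (forall i, ~ (exists j, g j = i) -> S i) ->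
  (forall i, S i -> S (g (f i))) -> S i.
have Cstep i : C i -> C (g (f i)) by move=> Ci S S0 S1; exact: S1 (Ci S S0 S1).
have Cinv j : C (g j) -> exists2 i, C i & f i = j.
  move=> Cgj; apply: contrapT => nC.
  have [||_ /(_ erefl)//] := Cgj (fun i => C i /\ i <> g j).
  - move=> i ni; split; first by move=> S S0 _; apply: S0.
    by move=> Ei; apply: ni; exists j.
  - move=> i [Ci _]; split; first exact: Cstep.
    by move=> /gI Efi; apply: nC; exists i.
have inv i : exists j, ~ C i -> g j = i.
  have [Ci|nCi] := pselect (C i); first by exists (f i).
  have [[j Ej]|ni] := pselect (exists j, g j = i); first by exists j.
  by case: nCi => S S0 _; apply: S0.
have [g' g'P] := choice inv.
pose h i := if pselect (C i) then f i else g' i.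
have [hC hN] : (forall i, C i -> h i = f i) /\ (forall i, ~ C i -> g (h i) = i).
  by split=> i; rewrite /h; case: pselect => // nCi _; apply: g'P.
exists h; split; last first.
  move=> i; have [Ci|nCi] := pselect (C i); first by rewrite hC.
  by rewrite -gd hN.
have hinv j : exists i, h i = j.
  have [/Cinv[i Ci <-]|nC] := pselect (C (g j)); first by exists i; rewrite hC.
  by exists (g j); apply: gI; rewrite hN.
have [k kP] := choice hinv.
exists k => // i; have : h (k (h i)) = h i by rewrite kP.
(* In the mixed cases the point outside [C] would be the image under [g \o f] of a point of [C],
   hence in [C]. *)
move: (k (h i)) => l Eh; have [Ci|nCi] := pselect (C i); have [Cl|nCl] := pselect (C l).
- by apply: fI; rewrite -!hC.
- by case: (nCl); rewrite -(hN l nCl) Eh hC //; apply: Cstep.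
- by case: (nCi); rewrite -(hN i nCi) -Eh hC //; apply: Cstep.
- by rewrite -(hN l) // Eh hN.
Qed.

(** * Comparing two bases adapted to the same filtration *)

Lemma morph_subMn (G H : zmodType) (f : G -> H) : {morph f : x y / (x + y)%R} ->
  forall x y a, f (x - y *+ a)%R = (f x - f y *+ a)%R.
Proof.
move=> fD x y a; apply: (addIr (f y *+ a)%R); rewrite subrK.
have f0 : f 0%R = 0%R by apply: (addIr (f 0%R)); rewrite -fD !add0r.
have fMn k : f (y *+ k)%R = (f y *+ k)%R by elim: k => [|k IH]; rewrite ?mulr0n // !mulrS fD IH.
by rewrite -fMn -fD subrK.
Qed.

(* f j is the least leading index, for the second basis, among the elements whose
   leading index for the first basis is j. If f i = f j with i < j, subtracting a
   multiple of a minimiser for i from one for j would lower the latter. *)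
Lemma filtered_basis_injection (p : nat) (G : zmodType) (J J' : Type)
    (X : G -> J -> 'F_p) (X' : G -> J' -> 'F_p) (c : J -> nat) (c' : J' -> nat) :
  prime p ->
  (forall j, {morph X^~ j : x y / (x + y)%R}) ->
  (forall j, {morph X'^~ j : x y / (x + y)%R}) ->
  (forall x, exists s, forall j, X' x j <> 0%R -> List.In j s) ->
  (forall j, exists x, X x j <> 0%R /\ forall i, X x i <> 0%R -> i = j) ->
  (forall j, (0 < c j)%N) ->
  (forall k x, (forall j, X x j <> 0%R -> (c j <= k)%N) <->
               (forall j, X' x j <> 0%R -> (c' j <= k)%N)) ->
  exists f : J -> J', injective f /\ forall j, c' (f j) = c j.
Proof.
move=> pr XD X'D X'fin Xsurj cpos filt.
have [le [wo lec]] := wo_graded c; have [le' [wo' lec']] := wo_graded c'.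
pose lead x j := greatest le (fun i => X x i <> 0%R) j.
pose lead' x j := greatest le' (fun i => X' x i <> 0%R) j.
have leadP x j : lead x j -> exists j', lead' x j'.
  move=> [Xj _]; have [s sP] := X'fin x.
  apply: (wo_greatest wo' sP); apply: contrapT => nX'.
  (* If [X' x] vanished everywhere, [x] would lie in the filtration step just below [c j], although
     [X x j] is nonzero. *)
  have : (c j <= (c j).-1)%N.
    by apply: (proj2 (filt _ x)) => // i X'i; case: nX'; exists i.
  by have := cpos j; lia.
have lead_c x j j' : lead x j -> lead' x j' -> c' j' = c j.
  move=> [Xj xj] [X'j' xj']; apply/eqP; rewrite eqn_leq; apply/andP; split.
    by apply: (proj1 (filt _ x)) => // i /xj /lec.
  by apply: (proj2 (filt _ x)) => // i /xj' /lec'.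
have exf j : exists j', least le' (fun j' => exists2 x, lead x j & lead' x j') j'.
  apply: (proj2 wo'); have [x [Xj xj]] := Xsurj j.
  have ldx : lead x j by split=> // i /xj ->; exact: wo_refl.
  by have [j' lj'] := leadP _ _ ldx; exists j', x.
have [f fP] := choice exf; exists f; split; last first.
  by move=> j; have [[x ldx ldx'] _] := fP j; apply: lead_c ldx'.
have Finj i j : le i j -> f i = f j -> i = j.
  move=> ij Ef; apply: contrapT => nij.
  have [[y ldy [ny y'max]] _] := fP i; have [[x ldx [nx x'max]] fmin] := fP j.
  rewrite -Ef in nx x'max fmin.
  (* The quotient is taken in ['F_p] and read as a natural number; it cancels the coordinate of [x]
     at [f i]. *)
  pose w := (x - y *+ (X' x (f i) / X' y (f i))%R)%R.
  have X'w : X' w (f i) = 0%R.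
    rewrite (morph_subMn (X'D _)) -mulr_natr natr_Zp mulrC divfK ?subrr //.
    exact/eqP.
  have ldw : lead w j.
    have Xyj : X y j = 0%R.
      by apply: contrapT => /(proj2 ldy) ji; apply: nij; exact: (proj1 wo).
    split; first by rewrite (morph_subMn (XD _)) Xyj mul0rn subr0; case: ldx.
    move=> k; rewrite (morph_subMn (XD _)).
    have [Xyk|Xyk] := pselect (X y k = 0%R).
      by rewrite Xyk mul0rn subr0; apply: (proj2 ldx).
    by move=> _; apply: (wo_trans wo) ij; apply: (proj2 ldy).
  have [l [nwl wmax]] := leadP _ _ ldw.
  have li : le' l (f i).
    move: nwl; rewrite (morph_subMn (X'D _)).
    have [Xyk|/y'max//] := pselect (X' y l = 0%R).
    by rewrite Xyk mul0rn subr0; apply: x'max.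
  apply: (nwl); rewrite (_ : l = f i) //; apply: (proj1 wo') => //.
  by apply: fmin; exists w => //; split.
by move=> i j Ef; case: (wo_total wo i j) => ij; [|symmetry]; apply: Finj.
Qed.

(** * Coordinates in a direct sum of cyclic p-groups *)

Section Coordinates.
Variables (G : zmodType) (I : Type) (p : nat) (n : I -> nat) (phi : G -> I -> nat).
Hypothesis phi_iso : dsum_iso p n phi.

Lemma coord_lt x i : (phi x i < p ^ n i)%N.
Proof. by case: phi_iso => /(_ x)[]. Qed.

Lemma coord_supp x : exists s, forall i, phi x i <> 0%N -> List.In i s.
Proof.
case: phi_iso => /(_ x)[_ [s sP]] _ _ _; exists s => i nz.
by apply: contrapT => /sP.
Qed.

Lemma coordD x y i : phi (x + y)%R i = ((phi x i + phi y i) %% p ^ n i)%N.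
Proof. by case: phi_iso => _ ->. Qed.

Lemma coord_inj x y : (forall i, phi x i = phi y i) -> x = y.
Proof. by case: phi_iso => _ _ inj _ xy; apply: inj; apply: funext. Qed.

Lemma coord0 i : phi 0%R i = 0%N.
Proof.
have := coordD 0%R 0%R i; rewrite addr0 => /eqP.
have := coord_lt 0%R i; set a := phi _ _ => lta.
rewrite -{1}(modn_small lta) -{1}[a]addn0 eqn_modDl mod0n modn_small // => /eqP->.
by [].
Qed.

Lemma coordMn x k i : phi (x *+ k)%R i = ((phi x i * k) %% p ^ n i)%N.
Proof.
elim: k => [|k IH]; first by rewrite mulr0n coord0 muln0 mod0n.
by rewrite mulrS coordD IH modnDmr mulnS.
Qed.

Lemma coordB x y i : (phi (x - y)%R i + phi y i = phi x i %[mod p ^ n i])%N.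
Proof. by rewrite -coordD subrK modn_small // coord_lt. Qed.

Lemma coordB0 x y i : phi y i = 0%N -> phi (x - y)%R i = phi x i.
Proof.
by move=> y0; have := coordB x y i; rewrite y0 addn0 !modn_small // coord_lt.
Qed.

Lemma coordBx x y i : phi y i = phi x i -> phi (x - y)%R i = 0%N.
Proof.
move=> yx; have /eqP := coordB x y i.
by rewrite yx -{2}[phi x i]add0n eqn_modDr mod0n modn_small ?coord_lt // => /eqP.
Qed.

Lemma coord_surj (f : I -> nat) (s : list I) :
  (forall i, (f i < p ^ n i)%N) -> (forall i, f i <> 0%N -> List.In i s) ->
  exists x, forall i, phi x i = f i.
Proof.
case: phi_iso => _ _ _ surj flt fs.
have [|x <-] := surj f; last by exists x.
by split=> //; exists s => i ni; apply: contrapT => /fs.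
Qed.

Lemma coord_unit i : (1 < p)%N -> (0 < n i)%N ->
  exists e, phi e i = 1%N /\ forall j, phi e j <> 0%N -> j = i.
Proof.
move=> p1 ni; have [] := @coord_surj (fun j => if pselect (j = i) then 1%N else 0%N) [:: i].
- move=> j; case: pselect => [Ej|nEj] /=; last by rewrite expn_gt0; lia.
  by rewrite Ej -[1%N](expn0 p) ltn_exp2l.
- by move=> j; case: pselect => // Ej; left.
- move=> e eE; exists e; split=> [|j]; rewrite eE; case: pselect => //.
Qed.

(** Universal property of the direct sum: [T] sums the multiples of the [x i] over a duplicate-free
    list containing the support, and the choice of list does not matter. It is additive because
    reducing a coordinate modulo p^(n i) discards a multiple of p^(n i), which kills [x i]. *)
Lemma coord_lift (H : zmodType) (x : I -> H) :
  (forall i, x i *+ p ^ n i = 0)%R ->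
  exists T : G -> H, {morph T : g h / (g + h)%R} /\
    forall g i, (forall j, phi g j <> 0%N -> j = i) -> T g = (x i *+ phi g i)%R.
Proof.
move=> x_ord.
(* [{classic I}] equips [I] with a decidable equality, so that duplicates can be removed. *)
have suppE g : exists s : seq {classic I}, uniq s /\ forall i : {classic I}, phi g i <> 0%N -> i \in s.
  have [s sP] := coord_supp g; exists (undup (s : seq {classic I})).
  split; first exact: undup_uniq.
  move=> i /sP; rewrite mem_undup; elim: s {sP} => //= a s IH [->|/IH].
    exact: mem_head.
  by rewrite inE => ->; rewrite orbT.
have [s sP] := choice suppE.
pose S g (r : seq {classic I}) := (\sum_(i <- r) x i *+ phi g i)%R.
have S_supp g r : uniq r -> (forall i : {classic I}, phi g i <> 0%N -> i \in r) -> S g r = S g (s g).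
  have filt q : S g q = (\sum_(i <- [seq i <- q | phi g i != 0%N]) x i *+ phi g i)%R.
    rewrite big_filter big_mkcond; apply: eq_bigr => i _.
    by case: eqP => [->|//]; rewrite mulr0n.
  have [sU sg] := sP g.
  move=> rU rg; rewrite !filt; apply: (@perm_big _ _ _ {classic I}); apply: uniq_perm; rewrite ?filter_uniq //.
  move=> i; rewrite !mem_filter; case: eqP => //= nz.
  by rewrite (rg i) // (sg i).
exists (fun g => S g (s g)); split=> [g h|g i gi].
  pose r := undup (s g ++ s h).
  have rP k (i : {classic I}) : (s k = s g \/ s k = s h) -> phi k i <> 0%N -> i \in r.
    move=> [Ek|Ek] /(proj2 (sP k)); rewrite mem_undup mem_cat Ek => -> //.
    by rewrite orbT.
  rewrite -(S_supp (g + h)%R r) ?undup_uniq //; last first.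
    move=> i; rewrite coordD => nz.
    have [g0|] := pselect (phi g i = 0%N); last by apply: rP; left.
    have [h0|] := pselect (phi h i = 0%N); last by apply: rP; right.
    by case: nz; rewrite g0 h0 mod0n.
  rewrite -(S_supp g r) ?undup_uniq //; last by move=> i; apply: rP; left.
  rewrite -(S_supp h r) ?undup_uniq //; last by move=> i; apply: rP; right.
  rewrite /S -big_split; apply: eq_bigr => i _ /=.
  rewrite -mulrnDr coordD [in RHS](divn_eq (phi g i + phi h i) (p ^ n i)).
  by rewrite mulrnDr mulnC mulrnA x_ord mul0rn add0r.
rewrite -(S_supp g [:: i : {classic I}]) //; first by rewrite /S big_seq1.
by move=> j /gi ->; exact: mem_head.
Qed.

Variables (pr : prime p) (npos : forall i, (0 < n i)%N).

Lemma residue_eq0 x i : ((phi x i)%:R = 0 :> 'F_p)%R <-> (p %| phi x i)%N.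
Proof.
by rewrite (dvdn_pcharf (pchar_Fp pr)); split=> /eqP.
Qed.

Lemma residueD x y i : ((phi (x + y) i)%:R = (phi x i)%:R + (phi y i)%:R :> 'F_p)%R.
Proof.
rewrite -natrD coordD -(Fp_nat_mod pr) modn_dvdm ?Fp_nat_mod //.
by rewrite -{1}[p]expn1 dvdn_exp2l.
Qed.

End Coordinates.

(** Indices with [n i = 0] contribute the trivial group, with 0 as its only residue. They are
    dropped because pickets need positive exponents. *)
Lemma dsum_iso_pos (G : zmodType) (I : Type) (p : nat) (n : I -> nat) (phi : G -> I -> nat) :
  prime p -> dsum_iso p n phi ->
  dsum_iso p (fun j : {i : I | (0 < n i)%N} => n (sval j)) (fun x j => phi x (sval j)).
Proof.
move=> pr isoG; have p_gt0 := prime_gt0 pr.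
have sub_supp (s : list I) : exists s' : list {i : I | (0 < n i)%N},
    forall j, List.In (sval j) s -> List.In j s'.
  elim: s => [|a s [s' IH]]; first by exists nil => j [].
  case: (posnP (n a)) => [a0|apos].
    by exists s' => j [Ej|/IH//]; have := svalP j; rewrite -Ej a0.
  exists (exist _ a apos :: s') => j [Ej|/IH js']; last by right.
  by left; case: j Ej => j jpos /= Ej; subst a; congr exist; exact: bool_irrelevance.
split=> [x|x y|x y xy|f [flt [s fs]]].
- split=> [j|]; first exact: coord_lt isoG _ _.
  have [s sP] := coord_supp isoG x; have [s' s'P] := sub_supp s.
  by exists s' => j js; apply: contrapT => nz; apply: js; apply: s'P; apply: sP.
- by apply: funext => j; exact: coordD isoG _ _ _.
- apply: (coord_inj isoG) => i; case: (posnP (n i)) => [i0|ipos].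
    have := coord_lt isoG x i; have := coord_lt isoG y i.
    by rewrite i0 expn0 !ltnS !leqn0 => /eqP-> /eqP->.
  exact: (congr1 (fun h => h (exist _ i ipos)) xy).
(* Extension of [f] by 0; matching on [idP] provides the positivity proof that the subtype
   requires. *)
pose F i := if @idP (0 < n i)%N is ReflectT ipos then f (exist _ i ipos) else 0%N.
have FE j : F (sval j) = f j.
  rewrite /F; case: j => i ipos /=; case: {-}_ / idP => // ipos'.
  by congr f; congr exist; exact: bool_irrelevance.
have [||x xE] := coord_surj isoG (f := F) (s := List.map sval s).
- move=> i; rewrite /F; case: {-}_ / idP => [ipos|_]; first exact: flt.
  by rewrite expn_gt0 p_gt0.
- move=> i; rewrite /F; case: {-}_ / idP => // ipos nz.
  have : List.In (exist _ i ipos) s by apply: contrapT => /fs.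
  by move=> /(List.in_map sval).
by exists x; apply: funext => j; rewrite xE.
Qed.

(** * Existence: a basis of G adapted to U *)

Section Picket.
Variables (p : nat) (G : zmodType) (U : G -> Prop).
Hypotheses (pr : prime p) (subU : is_subgroup U) (pU : forall x : G, U (x *+ p)%R).

Lemma subgroupB x y : U x -> U y -> U (x - y)%R.
Proof. by case: subU => _; apply. Qed.

Lemma subgroupD x y : U x -> U y -> U (x + y)%R.
Proof.
move=> Ux Uy; rewrite -[y]opprK; apply: subgroupB => //.
by rewrite -sub0r; apply: subgroupB => //; case: subU.
Qed.

Lemma subgroupMn x k : U x -> U (x *+ k)%R.
Proof.
move=> Ux; elim: k => [|k IH]; first by rewrite mulr0n; case: subU.
by rewrite mulrS; apply: subgroupD.
Qed.

Lemma unitriangular_basis (I : Type) (n : I -> nat) (phi : G -> I -> nat) :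
  (forall i, (0 < n i)%N) -> dsum_iso p n phi ->
  exists (phi' : G -> I -> nat) (t : I -> bool), dsum_iso p n phi' /\
    forall x, U x <-> forall i, picket_sub p (t i) (phi' x i).
Proof.
move=> npos isoG.
have [le [wo len]] := wo_graded n.
pose lead g i := greatest le (fun j => phi g j <> 0%N) i.
have lead0 g : g = 0%R \/ exists i, lead g i.
  have [|nz] := pselect (forall i, phi g i = 0%N).
    by move=> g0; left; apply: (coord_inj isoG) => i; rewrite g0 (coord0 isoG).
  right; have [s sP] := coord_supp isoG g; apply: (wo_greatest wo sP).
  exact/existsNP.
have lead_ind (P : G -> Prop) : P 0%R ->
    (forall g i, lead g i ->
      (forall g', (forall j, phi g' j <> 0%N -> le j i /\ j <> i) -> P g') -> P g) ->
    forall g, P g.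
  move=> P0 IP; suff Pl i g : lead g i -> P g.
    by move=> g; have [->|[i /Pl]] := lead0 g.
  move: i g; apply: (wo_ind wo) => i IH g ldg; apply: (IP g i ldg) => g' g'i.
  have [->//|[j ldj]] := lead0 g'.
  have [ji nji] := g'i j (proj1 ldj).
  exact: IH ldj.
pose reduced w i := phi w i = 1%N /\ forall j, phi w j <> 0%N -> le j i.
(* The flag records whether U contains an element with leading coefficient 1 at [i]; if not, the old
   basis element is kept. *)
have exx i : exists w : G * bool, [/\ reduced w.1 i, w.2 -> U w.1 &
    ~~ w.2 -> forall w, U w -> ~ reduced w i].
  have [[w [Uw rw]]|nw] := pselect (exists w, U w /\ reduced w i).
    by exists (w, true).
  have [e [e1 ei]] := coord_unit isoG (prime_gt1 pr) (npos i).
  exists (e, false); split=> //=; first by split=> // j /ei ->; exact: wo_refl.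
  by move=> _ w Uw rw; apply: nw; exists w.
have [xt xtP] := choice exx; pose x i := (xt i).1; pose t i := (xt i).2.
have x1 i : phi (x i) i = 1%N by case: (xtP i) => -[].
have xle i j : phi (x i) j <> 0%N -> le j i by case: (xtP i) => -[_ h] _ _; exact: h.
have [|T [TD TE]] := coord_lift isoG (x := x).
  (* The order is graded by [n], so the coordinates of [x i] sit at indices whose exponent is at
     most [n i]; hence p^(n i) kills [x i]. *)
  move=> i; apply: (coord_inj isoG) => j; rewrite (coordMn isoG) (coord0 isoG).
  have [->|/xle/len nji] := pselect (phi (x i) j = 0%N); first by rewrite mul0n mod0n.
  by apply/eqP; rewrite -/(dvdn _ _) dvdn_mull // dvdn_exp2l.
have [e eP] := choice (fun i => coord_unit isoG (prime_gt1 pr) (npos i)).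
have phie i a : (a < p ^ n i)%N -> phi (e i *+ a)%R i = a.
  by move=> lta; rewrite (coordMn isoG) (proj1 (eP i)) mul1n modn_small.
have phie0 i j a : j <> i -> phi (e i *+ a)%R j = 0%N.
  move=> ji; rewrite (coordMn isoG).
  by have [->|/(proj2 (eP i))//] := pselect (phi (e i) j = 0%N); rewrite mul0n mod0n.
have phix i a : (a < p ^ n i)%N -> phi (x i *+ a)%R i = a.
  by move=> lta; rewrite (coordMn isoG) x1 mul1n modn_small.
have xMle i a j : phi (x i *+ a)%R j <> 0%N -> le j i.
  rewrite (coordMn isoG).
  by have [->|/xle//] := pselect (phi (x i) j = 0%N); rewrite mul0n mod0n.
have Te i : T (e i) = x i by rewrite (TE _ i) ?(proj1 (eP i)) //; exact: (proj2 (eP i)).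
pose red g i := (g - e i *+ phi g i)%R.
have redE g i j : j <> i -> phi (red g i) j = phi g j.
  by move=> ji; rewrite /red (coordB0 isoG) // phie0.
have red0 g i : phi (red g i) i = 0%N.
  by rewrite /red (coordBx isoG) // phie // (coord_lt isoG).
have red_lt g i : lead g i -> forall j, phi (red g i) j <> 0%N -> le j i /\ j <> i.
  move=> [_ gi] j; have [->|ji] := pselect (j = i); first by rewrite red0.
  by rewrite redE // => /gi.
have Tred g i : T g = (T (red g i) + x i *+ phi g i)%R.
  by rewrite (morph_subMn TD) Te subrK.
have T0 : T 0%R = 0%R by apply: (addIr (T 0%R)); rewrite -TD !add0r.
(* [T] is unitriangular: [x i] has coefficient 1 at [i] and its other terms are lower, so the
   leading index and coefficient survive. *)
have Tlead g : forall i, lead g i ->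
    phi (T g) i = phi g i /\ forall j, phi (T g) j <> 0%N -> le j i.
  move: g; apply: lead_ind => [i [] |g i ldg IH k ldk]; first by rewrite (coord0 isoG).
  have -> : k = i by apply: (proj1 wo); [apply: (proj2 ldg); case: ldk|apply: (proj2 ldk); case: ldg].
  have redi j : phi (T (red g i)) j <> 0%N -> le j i /\ j <> i.
    have [->|[l ldl]] := lead0 (red g i); first by rewrite T0 (coord0 isoG).
    have [li nli] := red_lt _ _ ldg _ (proj1 ldl).
    have [_ jl] := IH _ (red_lt _ _ ldg) l ldl.
    move=> /jl jl'; split; first exact: (wo_trans wo) jl' li.
    by move=> Eji; apply: nli; apply: (proj1 wo) => //; rewrite -Eji.
  have redi0 : phi (T (red g i)) i = 0%N by apply: contrapT => /redi[].
  split; first by rewrite (Tred g i) (coordD isoG) redi0 phix ?modn_small ?(coord_lt isoG).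
  move=> j; rewrite (Tred g i) (coordD isoG).
  have [->|/redi[]//] := pselect (phi (T (red g i)) j = 0%N).
  by rewrite add0n modn_small ?(coord_lt isoG) // => /xMle.
have Tinj : injective T.
  move=> g h Tgh; apply/eqP; rewrite -subr_eq0; apply/eqP.
  have [//|[i ldi]] := lead0 (g - h)%R.
  have [] := Tlead _ _ ldi; rewrite -[h]mulr1n (morph_subMn TD) mulr1n Tgh subrr (coord0 isoG).
  by case: ldi => + _ E; rewrite -E.
(* Elimination from the top: subtracting the multiple of [x i] that matches the leading coefficient
   leaves a strictly lower element. *)
have Tsurj y : exists g, T g = y.
  move: y; apply: lead_ind => [|y i ldy IH]; first by exists 0%R.
  have [|g Tg] := IH (y - x i *+ phi y i)%R.
    move=> j; have [->|ji] := pselect (j = i).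
      by rewrite (coordBx isoG) // phix // (coord_lt isoG).
    split=> //; have [x0|/xMle//] := pselect (phi (x i *+ phi y i)%R j = 0%N).
    by apply: (proj2 ldy); rewrite -(coordB0 isoG _ x0).
  exists (g - e i *- phi y i)%R.
  by rewrite opprK TD Tg (TE _ i) ?phie ?(coord_lt isoG) // ?subrK // => j nz;
     apply: contrapT => ji; case: nz; rewrite phie0.
have UT g : U (T g) <-> forall i, picket_sub p (t i) (phi g i).
  move: g; apply: lead_ind => [|g i ldg IH].
    rewrite T0; split; last by case: subU.
    by move=> _ i; rewrite (coord0 isoG) /picket_sub; case: (t i).
  have {IH} [IH1 IH2] := IH _ (red_lt _ _ ldg).
  have Ux : picket_sub p (t i) (phi g i) -> U (x i *+ phi g i)%R.
    have [_ Uti _] := xtP i; rewrite /picket_sub; case E: (t i).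
      by move=> _; apply: subgroupMn; apply: Uti.
    by move=> /dvdnP[k ->]; rewrite mulrnA; apply: pU.
  split=> [UTg|pg]; last first.
    rewrite (Tred g i); apply: subgroupD; last exact: Ux.
    apply: IH2 => j; have [->|ji] := pselect (j = i); last by rewrite redE.
    by rewrite red0 /picket_sub; case: (t i).
  have pi : picket_sub p (t i) (phi g i).
    rewrite /picket_sub; case E: (t i) => //; apply: contrapT => /negP npg.
    have [_ _ nred] := xtP i; move: nred; rewrite -/(t i) E => /(_ isT).
    (* Bezout gives [u] inverting the leading coefficient modulo p^(n i). Then [T g *+ u] would be
       an element of U reduced at [i], which the flag [false] excludes. *)
    have : coprime (phi g i) (p ^ n i) by rewrite coprime_sym coprimeXl // prime_coprime.
    have g0 : (0 < phi g i)%N by rewrite lt0n; apply/eqP; case: ldg.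
    move=> /(coprimeP _ g0)[[u v] /= uv] /(_ (T g *+ u)%R); apply.
      exact: subgroupMn.
    have [Ti Tj] := Tlead _ _ ldg; split.
      rewrite (coordMn isoG) Ti mulnC (_ : _ * _ = v * p ^ n i + 1)%N; last by lia.
      by rewrite modnMDl modn_small // -(expn0 p) ltn_exp2l ?prime_gt1.
    move=> j; rewrite (coordMn isoG).
    by have [->|/Tj//] := pselect (phi (T g) j = 0%N); rewrite mul0n mod0n.
  move=> j; have [->//|ji] := pselect (j = i).
  rewrite -(redE g i j) //; apply: IH1.
  rewrite (_ : T _ = T g - x i *+ phi g i)%R; last by rewrite (Tred g i) addrK.
  by apply: subgroupB => //; exact: Ux.
(* Coordinates in the basis [x] are the old coordinates of the preimage under [T]. *)
have [S TS] := choice Tsurj.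
exists (fun y => phi (S y)), t; split; last first.
  by move=> y; rewrite -{1}(TS y); exact: UT.
case: (isoG) => _ _ phi_inj phi_surj.
split=> [y|y z|y z /phi_inj E|f /phi_surj[g <-]].
- by case: isoG.
- rewrite (_ : S (y + z)%R = S y + S z)%R; first by case: isoG.
  by apply: Tinj; rewrite TD !TS.
- by rewrite -(TS y) E TS.
- by exists (T g); congr phi; apply: Tinj; rewrite TS.
Qed.

(** * Uniqueness: a filtration intrinsic to the pair *)

Definition picket_class (J : Type) (m : J -> nat) (t : J -> bool) (j : J) : nat :=
  ((m j).*2 + ~~ t j)%N.

(* For k = 2a this is (U \cap G[p^a]) + G[p^(a-1)] + pG, and for k = 2a + 1 it
   is G[p^a] + pG. *)
Definition picket_filtration (k : nat) (x : G) : Prop :=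
  exists y z u, [/\ x = (y + z + u *+ p)%R, (y *+ p ^ k./2 = 0)%R,
    (z *+ p ^ (k.-1)./2 = 0)%R & odd k \/ U y].

(** A generator of P^m_m is killed by p^m and lies in U, so it enters at step 2m; one of P^m_(m-1)
    is outside U and has to wait for step 2m+1. Since the filtration ignores the decomposition,
    class bounds read off from two decompositions agree. *)
Lemma picket_filtrationP (J : Type) (m : J -> nat) (t : J -> bool) (phi : G -> J -> nat) k x :
  (forall j, (0 < m j)%N) -> dsum_iso p m phi ->
  (forall x, U x <-> forall j, picket_sub p (t j) (phi x j)) ->
  (forall j, ~~ (p %| phi x j) -> (picket_class m t j <= k)%N) <-> picket_filtration k x.
Proof.
move=> mpos isoG UE; have p_dvd j : p %| p ^ m j by rewrite -{1}[p]expn1 dvdn_exp2l.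
have p_gt0 := prime_gt0 pr.
split=> [xk|[y [z [u [-> ya zb Uy]]]] j]; last first.
  have ord v a : (v *+ p ^ a)%R = 0%R -> ~~ (p %| phi v j) -> (m j <= a)%N.
    move=> va npv; have := coordMn isoG v (p ^ a) j.
    rewrite va (coord0 isoG) => /esym/eqP; rewrite -/(dvdn _ _) Gauss_dvdr.
      by rewrite dvdn_Pexp2l // prime_gt1.
    by rewrite coprimeXl // prime_coprime.
  have -> : (p %| phi (y + z + u *+ p)%R j) = (p %| phi y j + phi z j).
    rewrite !(coordD isoG) (coordMn isoG) /dvdn modn_dvdm // -modnDm !modn_dvdm //.
    by rewrite modnMl addn0 modn_mod.
  have [py|npy] := boolP (p %| phi y j); last first.
    move=> _; have mj := ord _ _ ya npy.
    have : odd k \/ t j.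
      case: Uy => [|/UE/(_ j)]; first by left.
      by rewrite /picket_sub (negPf npy); case: (t j) => //; right.
    by rewrite /picket_class; case: (t j) => -[]; lia.
  rewrite dvdn_addr // => npz; have := ord _ _ zb npz; have := mpos j.
  by rewrite /picket_class; case: (t j); lia.
have [s sP] := coord_supp isoG x.
(* Coordinates in [cy] form a part killed by p^(k/2) and, for even k, inside U; those in [cz] form a
   part killed by p^((k-1)/2), with rounded-down halves. All others are divisible by p by hypothesis
   and go into [u *+ p]. *)
pose cy j := (m j <= k./2)%N && (odd k || t j).
pose cz j := ~~ cy j && (m j <= (k.-1)./2)%N.
have coordc (c : J -> bool) : exists v, forall j, phi v j = if c j then phi x j else 0%N.
  apply: (coord_surj isoG (s := s)) => j; case: (c j) => //.
  - exact: coord_lt isoG _ _.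
  - by rewrite expn_gt0 p_gt0.
  - exact: sP.
have [y yE] := coordc cy; have [z zE] := coordc cz.
have [||u uE] := coord_surj isoG (s := s)
    (f := fun j => if cy j || cz j then 0%N else phi x j %/ p).
- move=> j; case: ifP => _; first by rewrite expn_gt0 p_gt0.
  exact: leq_ltn_trans (leq_div _ _) (coord_lt isoG _ _).
- move=> j; case: ifP => // _ nz; apply: sP => x0; apply: nz; by rewrite x0 div0n.
have xlt j := coord_lt isoG x j.
exists y, z, u; split.
- apply: (coord_inj isoG) => j; rewrite !(coordD isoG) (coordMn isoG) yE zE uE.
  rewrite /cz; case Ey: (cy j) => /=.
    by rewrite addn0 mul0n mod0n addn0 !modn_small.
  case: leqP => mz /=; first by rewrite add0n mul0n mod0n addn0 !modn_small.
  rewrite mod0n add0n modn_mod divnK ?modn_small //.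
  apply: contraT => /xk; move: Ey mz; rewrite /cy /picket_class.
  by case: (t j); lia.
- apply: (coord_inj isoG) => j; rewrite (coordMn isoG) (coord0 isoG) yE.
  rewrite /cy; case: leqP => [my|_]; last by rewrite mul0n mod0n.
  by apply/eqP; rewrite -/(dvdn _ _) dvdn_mull // dvdn_exp2l.
- apply: (coord_inj isoG) => j; rewrite (coordMn isoG) (coord0 isoG) zE.
  rewrite /cz; case: leqP => [mz|_]; last by rewrite andbF mul0n mod0n.
  by apply/eqP; rewrite -/(dvdn _ _) dvdn_mull // dvdn_exp2l.
have [ok|ek] := boolP (odd k); [by left|right].
apply/UE => j; rewrite yE /cy (negPf ek) /picket_sub /=.
by case: (t j) => //; rewrite andbF.
Qed.

(** Coordinates reduced modulo p are additive with values in ['F_p], and [picket_filtrationP] ties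
    the classes on both sides to one filtration. *)
Lemma picket_injection (J : Type) (m : J -> nat) (t : J -> bool)
    (J' : Type) (m' : J' -> nat) (t' : J' -> bool) :
  picket_decomp U p m t -> picket_decomp U p m' t' ->
  exists f : J -> J', injective f /\
    forall j, picket_class m' t' (f j) = picket_class m t j.
Proof.
move=> [mpos [phi [isoG UE]]] [m'pos [phi' [isoG' UE']]].
have resP j (psi : G -> j -> nat) x i :
    ((psi x i)%:R <> 0 :> 'F_p)%R <-> ~~ (p %| psi x i).
  by rewrite (residue_eq0 _ pr); split=> /negP.
apply: (@filtered_basis_injection p G J J' (fun x j => (phi x j)%:R%R)
  (fun x j => (phi' x j)%:R%R)) => //.
- by move=> j x y; exact: residueD isoG pr mpos x y j.
- by move=> j x y; exact: residueD isoG' pr m'pos x y j.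
- move=> x; have [s sP] := coord_supp isoG' x; exists s => j nz; apply: sP => x0.
  by apply: nz; rewrite x0.
- move=> j; have [e [e1 ej]] := coord_unit isoG (prime_gt1 pr) (mpos j).
  exists e; split; first by rewrite e1 => /eqP; rewrite oner_eq0.
  by move=> i nz; apply: ej => e0; apply: nz; rewrite e0.
- by move=> j; rewrite /picket_class; have := mpos j; lia.
move=> k x; split=> xk j /resP.
  apply: (proj2 (picket_filtrationP k x m'pos isoG' UE')).
  by apply/(picket_filtrationP k x mpos isoG UE) => i /resP; exact: xk.
apply: (proj2 (picket_filtrationP k x mpos isoG UE)).
by apply/(picket_filtrationP k x m'pos isoG' UE') => i /resP; exact: xk.
Qed.

End Picket.

Theorem theorem1 (p : nat) (G : zmodType) (U : G -> Prop) :
  prime p ->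
  is_subgroup U ->
  direct_sum_cyclic_pgroups G p ->
  (forall x : G, U (x *+ p)%R) ->
  (exists (J : Type) (m : J -> nat) (t : J -> bool), picket_decomp U p m t) /\
  (forall (J : Type) (m : J -> nat) (t : J -> bool)
          (J' : Type) (m' : J' -> nat) (t' : J' -> bool),
     picket_decomp U p m t -> picket_decomp U p m' t' ->
     exists sigma : J -> J',
       bijective sigma /\ (forall j, m' (sigma j) = m j /\ t' (sigma j) = t j)).

Proof.
move=> pr subU [I [n [phi isoG]]] pU; split.
  have [phi' [t [isoG' UE]]] :=
    unitriangular_basis pr subU pU (fun j => svalP j) (dsum_iso_pos pr isoG).
  by exists {i : I | (0 < n i)%N}, (fun j => n (sval j)), t; split; [exact: svalP|exists phi'].
move=> J m t J' m' t' D D'.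
have [f [fI fc]] := picket_injection pr D D'.
have [g [gI gc]] := picket_injection pr D' D.
have [h [hB hc]] := graded_Cantor_Bernstein fI gI fc gc.
(* The parity of the class recovers the type, and its half, rounded down, the exponent. *)
exists h; split=> // j; have := hc j; rewrite /picket_class.
by case: (t j); case: (t' _) => /= E; split=> //; lia.
Qed.
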